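(* Let $E$ be an $m$-dimensional affine linear space of real $n \times n$ matrices with $m \leq \frac{n}{e}$ and $\mathbb{I}_n \in E$. Denote by $Pos_E$ the spectrahedron defined by the intersection of the cone of positive semidefinite matrices (PSD cone) with $E$, and define the following base $\widetilde{P}os_E$ for the spectrahedron $Pos_E$: $$ \widetilde{P}os_E := \{ Q \in Pos_E : \mathrm{Tr}(Q) = n \}. $$ Then there exists a polytope $K$ with $O(n^{m-2})$ facets which satisfies the following inclusions: $$ \widetilde{P}os_{E} - \mathbb{I}_n \subseteq K \subseteq \left(1 + \frac{n}{m}\right)^{\frac{3m}{n}} \left( \widetilde{P}os_{E} - \mathbb{I}_n \right). $$
   Context: $\mathbb{I}_n$ is the $n \times n$ identity matrix, $\mathrm{Tr}$ is the trace, and $e$ is Euler's number. The PSD cone is the set of symmetric positive semidefinite real $n \times n$ matrices. For a set $A$ of matrices, $A - \mathbb{I}_n = \{ Q - \mathbb{I}_n : Q \in A \}$, and for a real number $c$, $cA = \{ cQ : Q \in A \}$.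
   Formalization: It is additionally assumed that the trace is not constant on E (E is not contained in the hyperplane Tr = n); otherwise the base is all of Pos_E, possibly of dimension m, and the bound fails, e.g. for m = 1 with E = {I + tA}, A nonzero symmetric of trace 0. *)

(* Defs.v *)
From HB Require Import structures.
From mathcomp Require Import all_boot all_order all_algebra.
From mathcomp Require Import all_classical all_reals all_analysis.

Set Implicit Arguments.
Unset Strict Implicit.
Unset Printing Implicit Defensive.

Import Order.TTheory GRing.Theory Num.Theory.

Local Open Scope classical_set_scope.
Local Open Scope ring_scope.

Section AffineGeometry.
Variables (R : realType) (V : vectType R).
Implicit Types (A K F L : set V).

Definition affine_space (d : nat) L : Prop :=
  exists (x0 : V) (U : {vspace V}),
    \dim U = d /\ L = [set x0 + u | u in [set u | u \in U]].

(* The affine hull of [A], i.e. the least affine space containing it, has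
   dimension [d].  The empty set has no dimension, except in the degenerate
   case where [V] is a single point. *)
Definition affine_dim A (d : nat) : Prop :=
  exists L, [/\ affine_space d L, A `<=` L &
    forall d' L', affine_space d' L' -> A `<=` L' -> L `<=` L'].

(* The improper faces are included: [K] itself (f = 0, b = 0) and the empty
   set (f = 0, b = 1). *)
Definition face K F : Prop :=
  exists (f : {scalar V}) (b : R),
    (forall x, K x -> f x <= b) /\ F = [set x | K x /\ f x = b].

(* Under this convention a single point has no facets. *)
Definition facets K : set (set V) :=
  [set F | face K F /\ exists d, affine_dim K d.+1 /\ affine_dim F d].

End AffineGeometry.

Section Matrices.
Variables (R : realType) (n : nat).
Implicit Types (E K : set 'M[R]_n).

Definition polyhedron K : Prop :=
  exists (N : nat) (f : 'I_N -> {scalar 'M[R]_n}) (b : 'I_N -> R),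
    K = [set Q | forall i, f i Q <= b i].

Definition polytope K : Prop :=
  polyhedron K /\ exists r : R, forall Q, K Q -> forall i j, `|Q i j| <= r.

Definition psd : set 'M[R]_n :=
  [set Q | Q^T = Q /\ forall x : 'cV[R]_n, 0 <= (x^T *m Q *m x) 0 0].

Definition Pos E : set 'M[R]_n := psd `&` E.

Definition Pos_base E : set 'M[R]_n := [set Q | Pos E Q /\ \tr Q = n%:R].

Definition Pos_base_shifted E : set 'M[R]_n :=
  [set Q - 1%:M | Q in Pos_base E].

End Matrices.

(* Main.v *)
(** Write [E = 1 + U] and let [W] be the space of symmetric traceless matrices
in [U], of dimension [d < m].  For the Frobenius norm the shifted base is a
convex body of [W] containing the unit ball (Cauchy-Schwarz) and contained in
the ball of radius [n], because a psd matrix of trace [n] has Frobenius norm at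
most [n].

Dudley's construction then applies: enclose the body in the l1-sphere of radius
[M], of order [n sqrt d], cut the sphere into at most [2^d C(M+d-1, d-1)] cells
of diameter at most [2 sqrt d], project one point of each cell on the body and
keep the supporting half-spaces found in this way.  The resulting polytope is
within distance [2d/n] of the body, hence inside its dilation by
[1 + 2d/n <= 1 + 3m/n <= (1 + n/m)^(3m/n)].  The number of half-spaces is at
most a universal constant times [n^(d-1)], since [(c d)^((d-1)/2) / (d-1)!] is
bounded, and each facet of a polytope cut out by half-spaces containing a
common interior point is determined by one of them. *)

Require Import Defs.
From HB Require Import structures.
From mathcomp Require Import all_boot all_order all_algebra.
From mathcomp Require Import all_classical all_reals all_analysis.
From mathcomp Require Import ring lra zify.

Set Implicit Arguments.
Unset Strict Implicit.
Unset Printing Implicit Defensive.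

Import Order.TTheory GRing.Theory Num.Theory.
Import numFieldNormedType.Exports.

Local Open Scope classical_set_scope.
Local Open Scope ring_scope.

(** * The Frobenius inner product *)

Section Frobenius.
Variable R : realType.

Definition frob p q (A B : 'M[R]_(p, q)) : R :=
  \sum_(x : 'I_p * 'I_q) A x.1 x.2 * B x.1 x.2.

Lemma frobC p q (A B : 'M[R]_(p, q)) : frob A B = frob B A.
Proof. by apply: eq_bigr => x _; rewrite mulrC. Qed.

Fact frob_is_scalar p q (A : 'M[R]_(p, q)) : scalar (frob A).
Proof.
move=> a B C; rewrite /frob mulr_sumr -big_split /=.
by apply: eq_bigr => x _; rewrite !mxE; ring.
Qed.

HB.instance Definition _ p q (A : 'M[R]_(p, q)) :=
  GRing.isLinear.Build R 'M[R]_(p, q) R *%R (frob A) (frob_is_scalar A).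

Lemma frobDr p q (A B C : 'M[R]_(p, q)) : frob A (B + C) = frob A B + frob A C.
Proof. exact: raddfD. Qed.

Lemma frobNr p q (A B : 'M[R]_(p, q)) : frob A (- B) = - frob A B.
Proof. exact: raddfN. Qed.

Lemma frobZr p q c (A B : 'M[R]_(p, q)) : frob A (c *: B) = c * frob A B.
Proof. exact: scalarZ. Qed.

Lemma frobDl p q (A B C : 'M[R]_(p, q)) : frob (A + B) C = frob A C + frob B C.
Proof. by rewrite !(frobC _ C) frobDr. Qed.

Lemma frobNl p q (A B : 'M[R]_(p, q)) : frob (- A) B = - frob A B.
Proof. by rewrite frobC frobNr frobC. Qed.

Lemma frobZl p q c (A B : 'M[R]_(p, q)) : frob (c *: A) B = c * frob A B.
Proof. by rewrite frobC frobZr frobC. Qed.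

Lemma frobNN p q (A B : 'M[R]_(p, q)) : frob (- A) (- B) = frob A B.
Proof. by rewrite frobNl frobNr opprK. Qed.

Definition frobE := (frobDl, frobDr, frobNl, frobNr, frobZl, frobZr).

Lemma frob_ge0 p q (A : 'M[R]_(p, q)) : 0 <= frob A A.
Proof. by apply: sumr_ge0 => x _; rewrite -expr2 sqr_ge0. Qed.

Lemma frob_eq0 p q (A : 'M[R]_(p, q)) : frob A A = 0 -> A = 0.
Proof.
move/eqP; rewrite psumr_eq0 => [/allP A0|x _]; last by rewrite -expr2 sqr_ge0.
apply/matrixP => i j; rewrite mxE; apply/eqP.
by have := A0 (i, j) (mem_index_enum _); rewrite /= mulf_eq0 orbb.
Qed.

Lemma frob_gt0 p q (A : 'M[R]_(p, q)) : A != 0 -> 0 < frob A A.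
Proof.
move=> A0; rewrite lt_def frob_ge0 andbT; apply: contra A0 => /eqP /frob_eq0 ->.
exact: eqxx.
Qed.

Lemma frob_CS p q (A B : 'M[R]_(p, q)) :
  frob A B ^+ 2 <= frob A A * frob B B.
Proof.
have [->|B0] := eqVneq B 0.
  by rewrite -(scale0r 0) !frobE !mul0r !mulr0 expr0n.
have Bp := frob_gt0 B0.
have := frob_ge0 (frob B B *: A - frob A B *: B).
rewrite !frobE (frobC B A).
set a := frob A A; set b := frob B B; set c := frob A B => h.
rewrite -subr_ge0 -(pmulr_rge0 _ Bp) -/b; apply: le_trans h _.
by rewrite le_eqVlt; apply/orP; left; apply/eqP; ring.
Qed.

Lemma frobMx p q (A B : 'M[R]_(p, q)) : frob A B = \sum_i \sum_j A i j * B i j.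
Proof. by rewrite pair_bigA. Qed.

Lemma frob_rV d (u v : 'rV[R]_d) : frob u v = \sum_i u 0 i * v 0 i.
Proof. by rewrite frobMx big_ord1. Qed.

Lemma sqr_sum_norm_le d (u : 'rV[R]_d) :
  (\sum_i `|u 0 i|) ^+ 2 <= d%:R * frob u u.
Proof.
have := frob_CS (const_mx 1) (\row_i `|u 0 i|).
rewrite !frob_rV.
under eq_bigr do rewrite !mxE mul1r.
under [X in _ <= X * _]eq_bigr do rewrite !mxE mul1r.
under [X in _ <= _ * X]eq_bigr do rewrite !mxE -normrM ger0_norm -?expr2 ?sqr_ge0 // expr2.
by rewrite sumr_const card_ord.
Qed.

End Frobenius.

(** * Facets of a polyhedron *)

Section FacetCount.
Variables (R : realType) (V : vectType R).
Implicit Types (U : {vspace V}) (f : {scalar V}).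

Lemma affine_translate d (L : set V) (y : V) : affine_space d L -> L y ->
  exists2 U : {vspace V}, \dim U = d & L = [set z | z - y \in U].
Proof.
case=> x0 [U [dU ->]] [u uU <-{y}]; exists U => //; apply/seteqP; split => z /=.
  by case=> v vU <-; rewrite opprD addrACA subrr add0r rpredB.
move=> h; exists (z - x0); last by rewrite addrC subrK.
by rewrite -(subrK u (z - x0)) rpredD // -addrA -opprD.
Qed.

Lemma affine_space_translate U (y : V) :
  affine_space (\dim U) [set z | z - y \in U].
Proof.
exists y, U; split=> //; apply/seteqP; split => z /=.
  by move=> h; exists (z - y) => //; rewrite addrC subrK.
by case=> v vU <-; rewrite addrC addKr.
Qed.

Lemma mem_ker_scalar f (v : V) :
  (v \in lker (linfun (f : {linear V -> R^o}))) = (f v == 0).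
Proof. by rewrite memv_ker lfunE. Qed.

Lemma affine_level f (y : V) : exists d, affine_space d [set z | f z = f y].
Proof.
exists (\dim (lker (linfun (f : {linear V -> R^o})))).
have -> : [set z | f z = f y] =
    [set z | z - y \in lker (linfun (f : {linear V -> R^o}))].
  by apply/seteqP; split=> z /=; rewrite mem_ker_scalar raddfB subr_eq0 => /eqP.
exact: affine_space_translate.
Qed.

Lemma scalar_extrapolate f e (x y : V) :
  f (x + e *: (x - y)) = f x + e * (f x - f y).
Proof. by rewrite addrC scalarP raddfB addrC. Qed.

(** It lets a strictly feasible point move slightly in a given direction without leaving the
    polyhedron. *)
Lemma small_multiplier N (c g : 'I_N -> R) : (forall i, 0 < c i) ->
  exists2 eta : R, 0 < eta & forall i, eta * g i <= c i.
Proof.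
move=> c0; pose D := 1 + \sum_i `|g i| / c i.
have t0 i : 0 <= `|g i| / c i by rewrite divr_ge0 // ltW.
have D0 : 0 < D by rewrite ltr_pwDl // sumr_ge0.
exists D^-1 => [|i]; first by rewrite invr_gt0.
rewrite mulrC ler_pdivrMr //; apply: le_trans (ler_norm _) _.
rewrite -ler_pdivrMl // mulrC /D (bigD1 i) //= addrCA lerDl.
by rewrite addr_ge0 // sumr_ge0.
Qed.

Section Polyhedron.
Variables (W : {vspace V}) (N : nat) (f : 'I_N -> {scalar V}) (b : 'I_N -> R).
Hypothesis b_gt0 : forall i, 0 < b i.

Let K := [set x | x \in W /\ forall i, f i x <= b i].

(** Induction on the list of inequalities: the midpoint of two points of [F] is strict wherever one
    of them is. *)
Lemma strict_point (F : set V) : F `<=` K -> F !=set0 ->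
  (forall x y, F x -> F y -> F (2^-1 *: (x + y))) ->
  (forall i, exists2 x, F x & f i x < b i) ->
  exists2 x, F x & forall i, f i x < b i.
Proof.
move=> FK [x0 Fx0] Fc H.
have [x Fx xs] : exists2 x, F x & forall i, i \in enum 'I_N -> f i x < b i.
  elim: (enum 'I_N) => [|i s [x Fx xs]]; first by exists x0.
  have [y Fy yi] := H i; exists (2^-1 *: (x + y)); first exact: Fc.
  move=> j; rewrite inE scalarZ raddfD.
  have [_ xK] := FK _ Fx; have [_ yK] := FK _ Fy.
  by have := xK j; have := yK j; move=> hy hx /orP[/eqP ji|/xs hj]; subst; lra.
by exists x => // i; apply: xs; rewrite mem_enum.
Qed.

(* A functional whose maximum over [K] is attained at a point where no
   inequality is tight is constant on [K]. *)
Lemma face_tight (F : set V) : face K F -> F !=set0 -> F <> K ->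
  exists i, F `<=` [set x | f i x = b i].
Proof.
move=> [g [c [Kg FE]]] F0 FneK; apply: contrapT => noi; apply: FneK.
have [||||x Fx xs] := @strict_point F.
- by rewrite FE => x [].
- exact: F0.
- move=> x y; rewrite FE => -[[xW xK] xc] [[yW yK] yc]; split; last first.
    by rewrite scalarZ raddfD /= xc yc; lra.
  split=> [|i]; first by rewrite rpredZ // rpredD.
  by rewrite scalarZ raddfD /=; have := xK i; have := yK i; lra.
- move=> i; apply: contrapT => h; apply: noi; exists i => x Fx /=.
  apply/eqP; rewrite eq_le; apply/andP; split.
    by move: Fx; rewrite FE => -[[_ ->]].
  by rewrite leNgt; apply/negP => lt; apply: h; exists x.
move: Fx; rewrite FE => -[[xW xK] xc].
apply/seteqP; split=> [y []//|y Ky]; split=> //.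
(* Prolonging the segment from [y] to [x] slightly beyond [x] stays in [K]. There [g] is at most
   [c], and [g x = c], so linearity gives [c <= g y]. *)
have [i|eta e0 eP] := @small_multiplier N (fun i => b i - f i x)
  (fun i => f i x - f i y); first by rewrite subr_gt0.
apply/eqP; rewrite eq_le Kg //=.
have : g (x + eta *: (x - y)) <= c.
  apply: Kg; split; first by rewrite rpredD // rpredZ // rpredB //; case: Ky.
  by move=> i; rewrite scalar_extrapolate; have := eP i; lra.
by rewrite scalar_extrapolate xc gerDl pmulr_rle0 // subr_le0.
Qed.

(** [F] lies in some hyperplane [f i = b i], which misses 0 and so cuts the affine hull of [K] in
    codimension one. By dimension this section is the affine hull of [F]. *)
Lemma facet_tight (F : set V) : facets K F ->
  exists i, F = K `&` [set x | f i x = b i].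
Proof.
have K0 : K 0 by split=> [|i]; rewrite ?rpred0 // raddf0 ltW.
move=> [Fface [d [[LK [aLK KL minLK]] [LF [aLF FL minLF]]]]].
have [UK dUK LKE] := affine_translate aLK (KL _ K0).
have FK : F `<=` K by case: Fface => g [c [_ ->]] x [].
have LFK : LF `<=` LK by apply: minLF aLK _; apply: subset_trans KL.
have Fn0 : F !=set0.
  (* The hull of an empty [F] would lie in every singleton, whereas [UK] has positive dimension and
     so contains two distinct points. *)
  apply: contrapT => /set0P/negP/negPn/eqP F0.
  have sub y : LF `<=` [set y].
    apply: (minLF 0); last by rewrite F0; apply: sub0set.
    have := affine_space_translate 0%VS y; rewrite dimv0.
    have -> // : [set z | z - y \in 0%VS] = [set y].
    by apply/seteqP; split=> z /=; rewrite memv0 subr_eq0 => /eqP.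
  have [v vU v0] : exists2 v, v \in UK & v != 0.
    by exists (vpick UK); rewrite ?memv_pick // vpick0 -dimv_eq0 dUK.
  have [y0 [U [_ LFE]]] := aLF.
  have Ly : LF y0 by rewrite LFE; exists 0; rewrite ?addr0 //= rpred0.
  by move: v0; rewrite -(sub v _ Ly) (sub 0 _ Ly) eqxx.
have [y Fy] := Fn0.
have [UF dUF LFE] := affine_translate aLF (FL _ Fy).
have FneK : F <> K.
  move=> FKE; have : LK `<=` LF by apply: minLK aLF _; rewrite -FKE.
  rewrite LKE LFE => sub.
  have yUF : - y \in UF by have := sub 0; rewrite /= subrr sub0r; apply; rewrite rpred0.
  have : (UK <= UF)%VS.
    apply/subvP => u uU; have := sub u; rewrite /= subr0 => /(_ uU) h.
    by rewrite -(subrK y u) rpredD // -rpredN.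
  by move/dimvS; rewrite dUK dUF ltnn.
have [i Fi] := face_tight Fface Fn0 FneK.
exists i; apply/seteqP; split=> [x Fx|x [Kx fx]]; first by split; [exact: FK|exact: Fi].
have LKy : LK y by apply: LFK; apply: FL.
pose k := lker (linfun (f i : {linear V -> R^o})).
have UFE : UF = (UK :&: k)%VS.
  apply/eqP; rewrite eqEdim; apply/andP; split.
    apply/subvP => u uU; rewrite memv_cap.
    have LFyu : LF (y + u) by rewrite LFE /= addrC addKr.
    have := LFK _ LFyu; rewrite LKE /= subr0 => yuU.
    have yU : y \in UK by move: LKy; rewrite LKE /= subr0.
    rewrite -(addKr y u) rpredD ?rpredN //= mem_ker_scalar addKr.
    have [e ae] := affine_level (f i) y.
    have := minLF _ _ ae; rewrite (Fi _ Fy) => /(_ Fi _ LFyu) /=.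
    by rewrite raddfD /= (Fi _ Fy) => /eqP; rewrite -subr_eq0 addrAC subrr add0r.
  rewrite dUF -ltnS -dUK ltn_neqAle (dimvS (capvSl _ _)) andbT.
  apply/negP => /eqP eqd.
  have : (UK :&: k)%VS == UK by rewrite eqEdim capvSl eqd leqnn.
  move=> /eqP/capv_idPl /subvP /(_ y); rewrite mem_ker_scalar (Fi _ Fy).
  by move: LKy; rewrite LKE /= subr0 => yU /(_ yU); rewrite gt_eqF.
have LFx : LF x.
  rewrite LFE UFE /= memv_cap mem_ker_scalar raddfB /= fx (Fi _ Fy) subrr eqxx andbT.
  by move: (KL _ Kx) LKy; rewrite LKE /= !subr0 => *; rewrite rpredB.
(* The level set [g = c] is affine and contains [F], hence also [LF] and the point [x]. *)
have [g [c [Kg FE]]] := Fface.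
rewrite FE; split=> //.
move: Fy; rewrite FE => -[_ yc].
have [e ae] := affine_level g y.
have := minLF _ _ ae; rewrite yc; apply => //.
by rewrite FE => z [].
Qed.

(** An inequality may define no facet and several may define the same one, whence [M <= N]. *)
Lemma card_facets_le : exists2 M, (M <= N)%N & (facets K #= `I_M)%card.
Proof.
pose T k := if insub k is Some i then K `&` [set x | f i x = b i] else set0.
have sub : facets K `<=` T @` `I_N.
  by move=> F /facet_tight[i ->]; exists i; rewrite /T /= ?valK.
have le : (facets K #<= `I_N)%card.
  apply: card_le_trans (subset_card_le sub) _.
  exact: card_image_le.
have [M cM] : exists M, (facets K #= `I_M)%card.
  apply/finite_setP; apply: card_le_finite le _; exact: finite_II.
exists M => //; rewrite -card_le_II; apply: card_le_trans le.
by move: cM; rewrite card_eq_le => /andP[].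
Qed.

End Polyhedron.
End FacetCount.

(** * Nearest points in an intersection of half-spaces *)

Section NearestPoint.
Variables (R : realType) (d : nat) (J : Type) (g : J -> 'rV[R]_d) (h : J -> R).

Lemma continuous_sumr (T : topologicalType) I (s : seq I) (F : I -> T -> R) :
  (forall i, continuous (F i)) -> continuous (fun x => \sum_(i <- s) F i x).
Proof.
move=> cF x; elim: s => [|i s IH].
  rewrite (_ : (fun _ => _) = fun=> 0); first exact: cvg_cst.
  by apply/funext => y; rewrite big_nil.
rewrite (_ : (fun _ => _) = F i \+ (fun y => \sum_(j <- s) F j y)).
  by apply: cvgD IH; exact: cF.
by apply/funext => y; rewrite big_cons.
Qed.

Lemma continuous_frob_sub (w : 'rV[R]_d) :
  continuous (fun x : 'rV[R]_d => frob (x - w) (x - w)).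
Proof.
rewrite (_ : (fun _ => _) = fun x : 'rV_d => \sum_i (x 0 i - w 0 i) * (x 0 i - w 0 i)).
  apply: continuous_sumr => i x.
  have cf : continuous (fun y : 'rV[R]_d => y 0 i - w 0 i).
    by move=> y; apply: (cvgB (@coord_continuous R 1 d 0 i y) (cvg_cst _)).
  exact: (cvgM (cf x) (cf x)).
by apply/funext => x; rewrite frob_rV; apply: eq_bigr => i _; rewrite !mxE.
Qed.

Lemma continuous_frob (w : 'rV[R]_d) : continuous (frob w : 'rV[R]_d -> R).
Proof.
rewrite (_ : frob w = fun x : 'rV_d => \sum_i w 0 i * x 0 i); last first.
  by apply/funext => x; rewrite frob_rV.
apply: continuous_sumr => i x.
exact: (cvgM (cvg_cst _) (@coord_continuous R 1 d 0 i x)).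
Qed.

Let S := [set c | forall j, frob (g j) c <= h j].

Lemma convex_halfspaces x y t : S x -> S y -> 0 <= t -> t <= 1 ->
  S ((1 - t) *: x + t *: y).
Proof.
move=> Sx Sy t0 t1 j; rewrite frobDr !frobZr.
have := Sx j; have := Sy j => hy hx.
apply: (@le_trans _ _ ((1 - t) * h j + t * h j)); last by rewrite -mulrDl subrK mul1r.
by apply: lerD; apply: ler_wpM2l; rewrite ?subr_ge0.
Qed.

Lemma closed_halfspaces : closed S.
Proof.
rewrite (_ : S = \bigcap_j [set c | frob (g j) c <= h j]); last first.
  by apply/seteqP; split=> [c Sc j _|c Sc j]; [exact: Sc|exact: (Sc j)].
apply: closed_bigI => j _.
apply: (@preimage_closed _ _ (frob (g j)) [set x | x <= h j]); last exact: closed_le.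
by move=> x _; exact: continuous_frob.
Qed.

(** Compactness gives a point [p] minimising the distance to [x]; the inequality is the obtuse angle
    criterion for this minimiser. *)
Lemma exists_nearest r x : 0 <= r -> (forall c, S c -> frob c c <= r ^+ 2) -> S !=set0 ->
  exists2 p, S p & forall q, S q -> frob (x - p) (q - p) <= 0.
Proof.
move=> r0 Sr S0.
have cS : compact S.
  apply: bounded_closed_compact closed_halfspaces.
  exists r; split=> [|t rt c Sc]; first exact: num_real.
  apply: le_trans (ltW rt); rewrite /Num.norm /= mx_normrE; apply: bigmax_le => // -[i j] _ /=.
  rewrite -(ler_pXn2r (ltn0Sn 1)) ?nnegrE //; apply: le_trans (Sr _ Sc).
  rewrite frob_rV (ord1 i) real_normK ?num_real // (bigD1 j) //= -expr2 lerDl.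
  by apply: sumr_ge0 => l _; rewrite -expr2 sqr_ge0.
have [p pS pmin] := compact_EVT_min S0 cS
  (continuous_subspaceT (@continuous_frob_sub x)).
rewrite inE in pS; exists p => // q Sq; rewrite leNgt; apply/negP.
move ux: (x - p) => u; move vq: (q - p) => v pos.
have v0 : 0 < frob v v.
  by apply: frob_gt0; apply: contraTneq pos => ->; rewrite raddf0 ltxx.
(* This [t] minimises the squared length of [u - t *: v] on [0, 1]; it would yield a point of [S]
   closer to [x] than [p]. *)
pose t := Num.min 1 (frob u v / frob v v).
have t0 : 0 < t by rewrite lt_min ltr01 divr_gt0.
have t1 : t <= 1 by rewrite ge_min lexx.
have tv : t * frob v v <= frob u v.
  by rewrite -ler_pdivlMr // ge_min lexx orbT.
have : S ((1 - t) *: p + t *: q) by apply: convex_halfspaces => //; exact: ltW.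
move=> /mem_set /pmin.
have -> : (1 - t) *: p + t *: q - x = t *: v - u.
  by rewrite -ux -vq; apply/rowP => i; rewrite !mxE; ring.
have -> : p - x = - u by rewrite -ux opprB.
rewrite !frobE (frobC v u) => ineq.
have := ler_wpM2l (ltW t0) tv.
have := mulr_gt0 t0 pos.
lra.
Qed.

End NearestPoint.

(** * Dudley's approximation *)

Section Cells.
Variables (R : realType) (k M : nat).
Implicit Types w : 'rV[R]_k.+1.

Definition l1norm w : R := \sum_i `|w 0 i|.

Definition partial_l1 w (j : nat) : R := \sum_(i < k.+1 | (i < j)%N) `|w 0 i|.

(* Recording the integer parts of the partial sums, rather than those of the
   coordinates, leaves only [k] free parameters on the sphere
   [l1norm w = M]. *)
Definition cell w : {ffun 'I_k.+1 -> bool} * k.-tuple 'I_M.+1 :=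
  ([ffun i => 0 <= w 0 i], [tuple inord (Num.truncn (partial_l1 w j.+1)) | j < k]).

(** Partial sums increase, so only nondecreasing tuples occur; this brings the count down to a
    binomial coefficient. *)
Definition cells := [set c : {ffun 'I_k.+1 -> bool} * k.-tuple 'I_M.+1 |
  sorted leq [seq val i | i <- c.2]]%SET.

Lemma card_cells : #|cells| = (2 ^ k.+1 * 'C(k + M, k))%N.
Proof.
have -> : cells = finset.setX finset.setT [set t : k.-tuple 'I_M.+1 |
    sorted leq [seq val i | i <- t]]%SET.
  by apply/setP => -[s t]; rewrite !inE.
by rewrite cardsX card_sorted_tuples cardsT card_ffun card_bool card_ord.
Qed.

Lemma partial_l1_mono w i j : (i <= j)%N -> partial_l1 w i <= partial_l1 w j.
Proof.
move=> ij; rewrite /partial_l1 [leRHS](bigID (fun l : 'I_k.+1 => (l < i)%N)) /=.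
rewrite (eq_bigl (fun l : 'I_k.+1 => (l < j)%N && (l < i)%N)) => [|l].
  by rewrite lerDl sumr_ge0.
by case: (ltnP l i) => [/leq_trans->//|]; rewrite andbF.
Qed.

Lemma partial_l1_ge0 w j : 0 <= partial_l1 w j.
Proof. exact: sumr_ge0. Qed.

Lemma partial_l1_last w : partial_l1 w k.+1 = l1norm w.
Proof. by apply: eq_bigl => i; rewrite ltn_ord. Qed.

Lemma partial_l1_step w (i : 'I_k.+1) :
  `|w 0 i| = partial_l1 w i.+1 - partial_l1 w i.
Proof.
rewrite /partial_l1 (bigD1 i) //=.
rewrite (eq_bigl (fun l : 'I_k.+1 => (l < i)%N)) ?addrK // => l.
by rewrite ltnS ltn_neqAle andbC.
Qed.

(** Ensures that [inord] in [cell] loses nothing on the sphere. *)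
Lemma truncn_partial_l1 w j : l1norm w = M%:R -> (j <= k.+1)%N ->
  (Num.truncn (partial_l1 w j) < M.+1)%N.
Proof.
move=> wM jk; rewrite ltnS truncn_le_nat.
by apply: le_lt_trans (partial_l1_mono _ jk) _; rewrite partial_l1_last wM ltr_nat.
Qed.

Lemma cell_mem w : l1norm w = M%:R -> cell w \in cells.
Proof.
move=> wM; rewrite inE /= -map_comp.
have -> : [seq (val \o (fun j : 'I_k => inord (Num.truncn (partial_l1 w j.+1)) : 'I_M.+1)) i
    | i <- enum 'I_k] = [seq Num.truncn (partial_l1 w j.+1) | j <- iota 0 k].
  rewrite -val_enum_ord -map_comp; apply: eq_map => j /=.
  by rewrite inordK // truncn_partial_l1 // ltnW // ltnS.
apply: (homo_sorted (e := leq)) (iota_sorted 0 k) => i j ij.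
by apply: le_truncn; apply: partial_l1_mono.
Qed.

(** Partial sums with equal integer parts differ by at most 1, and the extreme ones, 0 and [M],
    agree. Each absolute value is a difference of two partial sums, so it varies by at most 2; as
    signs agree, so does each coordinate. *)
Lemma cell_dist w w' : l1norm w = M%:R -> l1norm w' = M%:R -> cell w = cell w' ->
  frob (w - w') (w - w') <= 4 * k.+1%:R.
Proof.
move=> wM wM' E.
have /ffunP sgn := congr1 fst E.
have flr j := congr1 (fun c => tnth c.2 j) E.
have close j : (j <= k.+1)%N -> `|partial_l1 w j - partial_l1 w' j| <= 1.
  case: j => [_|j]; first by rewrite /partial_l1 !big_pred0 // subrr normr0.
  rewrite ltnS leq_eqVlt => /predU1P[->|jk].
    by rewrite !partial_l1_last wM wM' subrr normr0.
  have := flr (Ordinal jk); rewrite !tnth_mktuple /=.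
  move=> /(congr1 val); rewrite /= !inordK ?truncn_partial_l1 // ?ltnS ?(ltnW jk) // => Et.
  have /andP[] := truncn_itv (partial_l1_ge0 w j.+1).
  have /andP[] := truncn_itv (partial_l1_ge0 w' j.+1).
  by rewrite Et -natr1 => ????; rewrite ler_norml; apply/andP; split; lra.
have d2 i : `|w 0 i - w' 0 i| <= 2.
  have := close i (ltnW (ltn_ord i)); have := close i.+1 (ltn_ord i).
  have := partial_l1_step w i; have := partial_l1_step w' i.
  have := sgn i; rewrite !ffunE !ler_norml.
  case: (ger0P (w 0 i)) => h; case: (ger0P (w' 0 i)) => h' // _ ?? /andP[??] /andP[??];
  by apply/andP; split; lra.
rewrite frob_rV; apply: (@le_trans _ _ (\sum_(i < k.+1) 4)).
  apply: ler_sum => i _; rewrite !mxE -expr2 -real_normK ?num_real //.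
  by rewrite (_ : 4 = 2 ^+ 2); [rewrite ler_pXn2r ?nnegrE|ring].
by rewrite sumr_const card_ord mulr_natr.
Qed.

End Cells.

Section Dudley.
Variable R : realType.

(** Here [a] and [a'] are normals at [p] and [p'], and [p + tau *: a] satisfies the inequality at
    [p']. Since the inner product of [a - a'] and [p - p'] is nonnegative, [a] and [a'] are as close
    as the sphere points [a + p] and [a' + p']. Polarization also bounds that product by [D], which
    limits how far [tau *: a] can exceed the half-space at [p']. *)
Lemma dudley_estimate d (p p' a a' : 'rV[R]_d) (tau r D : R) :
  0 < r -> 0 <= tau -> 4 * D <= r ^+ 2 ->
  r ^+ 2 <= frob a a -> r ^+ 2 <= frob a' a' ->
  frob a (p' - p) <= 0 -> frob a' (p - p') <= 0 ->
  frob (a + p - (a' + p')) (a + p - (a' + p')) <= 4 * D ->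
  frob a' (p + tau *: a - p') <= 0 ->
  frob (tau *: a) (tau *: a) <= (2 * D / r) ^+ 2.
Proof.
move=> r0 t0 Dr ra ra' az a'z close half.
have ez := frob_ge0 (a - a' - (p - p')).
have ee := frob_ge0 (p - p').
have r2 : 0 < r ^+ 2 by rewrite exprn_gt0.
rewrite expr_div_n ler_pdivlMr // frobZl frobZr.
move: az a'z close half ez ee; rewrite !frobE.
rewrite !(frobC a' a) !(frobC p a) !(frobC p' a) !(frobC p a') !(frobC p' a') !(frobC p' p).
move: ra ra'.
move: (frob a a) (frob a' a') (frob a a') (frob a p) (frob a p') (frob a' p)
  (frob a' p') (frob p p) (frob p' p') (frob p p') =>
  aa bb ab ap ap' bp bp' pp qq pq ra ra' az a'z close half ez ee.
have abD : aa / 2 <= ab by lra.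
have taD : tau * ab <= D by lra.
have taa : tau * aa <= 2 * D by have := ler_wpM2l t0 abD; lra.
have aa0 : 0 <= tau * aa by rewrite mulr_ge0 // (le_trans (ltW r2)).
apply: le_trans (ler_wpM2l (mulr_ge0 t0 aa0) ra) _.
rewrite (_ : tau * (tau * aa) * aa = (tau * aa) ^+ 2); last by ring.
by rewrite ler_pXn2r // nnegrE // (le_trans aa0).
Qed.

Lemma frob_sub_ge d (w p : 'rV[R]_d) r : 4 * r ^+ 2 <= frob w w ->
  frob p p <= r ^+ 2 -> r ^+ 2 <= frob (w - p) (w - p).
Proof.
have := frob_ge0 (w - p - p); rewrite !frobE !(frobC p w).
by move: (frob w w) (frob p p) (frob w p) => *; lra.
Qed.

Variables (k M n : nat) (J : Type) (g : J -> 'rV[R]_k.+1) (h : J -> R).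
Let S := [set c | forall j, frob (g j) c <= h j].
Hypothesis n_gt0 : (0 < n)%N.
Hypothesis S_ball : forall x, frob x x <= 1 -> S x.
Hypothesis S_bounded : forall x, S x -> frob x x <= n%:R ^+ 2.
Hypothesis k_le_n : (4 * k.+1 <= n ^ 2)%N.
Hypothesis M_large : (4 * n ^ 2 * k.+1 <= M ^ 2)%N.

Definition normal_at (w p : 'rV[R]_k.+1) :=
  S p /\ forall q, S q -> frob (w - p) (q - p) <= 0.

Let n_pos : 0 < n%:R :> R. Proof. by rewrite ltr0n. Qed.

Lemma frob_l1_sphere (w : 'rV[R]_k.+1) : l1norm w = M%:R -> 4 * n%:R ^+ 2 <= frob w w :> R.
Proof.
move=> wM; have : l1norm w ^+ 2 <= k.+1%:R * frob w w := sqr_sum_norm_le w.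
rewrite wM => h1.
have k0 : 0 < k.+1%:R :> R by rewrite ltr0n.
rewrite -(ler_pM2l k0); apply: le_trans h1.
by rewrite mulrC -!natrX -!natrM ler_nat.
Qed.

Lemma normal_far (w p : 'rV[R]_k.+1) : l1norm w = M%:R -> normal_at w p ->
  n%:R ^+ 2 <= frob (w - p) (w - p).
Proof.
by move=> /frob_l1_sphere hw [/S_bounded hp _]; exact: frob_sub_ge.
Qed.

(** A small positive multiple of the normal lies in the unit ball, hence in [S], and the normal
    takes a positive value there. *)
Lemma normal_level_gt0 (w p : 'rV[R]_k.+1) : l1norm w = M%:R -> normal_at w p ->
  0 < frob (w - p) p.
Proof.
move=> wM np; have := normal_far wM np; case: np => Sp.
move: (w - p) => a pn an.
have a0 : 0 < frob a a by apply: lt_le_trans an; rewrite exprn_gt0.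
pose t := (1 + frob a a)^-1.
have t0 : 0 < t by rewrite invr_gt0 addr_gt0.
have ta : t * (1 + frob a a) = 1 by rewrite mulVf // gt_eqF // addr_gt0.
have : S (t *: a).
  apply: S_ball; rewrite frobZl frobZr.
  have t1 : t <= 1 by rewrite -ta ler_peMr ?lerDl // ltW.
  have h1 : t * frob a a <= 1 by rewrite -[leRHS]ta ler_pM2l // lerDr.
  by apply: le_trans h1; rewrite ler_piMl // mulr_ge0 // ltW.
move=> /pn; rewrite frobDr frobNr frobZr subr_le0; apply: lt_le_trans.
exact: mulr_gt0.
Qed.

(** Intermediate values along the ray: [p] is inside the sphere because [M] is large, and at [s1]
    the coordinate [i] alone already has absolute value at least [M]. *)
Lemma extend_to_sphere (p u : 'rV[R]_k.+1) : S p -> u != 0 ->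
  exists2 s : R, 0 <= s & l1norm (p + s *: u) = M%:R.
Proof.
move=> Sp u0.
have [i ui] : exists i, u 0 i != 0.
  apply: contrapT => nou; move/eqP: u0; apply; apply/rowP => i; rewrite mxE.
  by apply/eqP/negPn/negP => ui; apply: nou; exists i.
have ui0 : 0 < `|u 0 i| by rewrite normr_gt0.
pose s1 := (M%:R + `|p 0 i|) / `|u 0 i|.
have s10 : 0 <= s1 by rewrite divr_ge0 // addr_ge0.
have cont : continuous (fun s : R => l1norm (p + s *: u)).
  apply: continuous_sumr => j s.
  rewrite (_ : (fun _ => _) = fun s : R => `|p 0 j + s * u 0 j|); last first.
    by apply/funext => t; rewrite !mxE.
  apply: (@continuous_comp _ _ _ (fun s : R => p 0 j + s * u 0 j) Num.norm).
    by apply: cvgD; [exact: cvg_cst|apply: cvgM; [exact: cvg_id|exact: cvg_cst]].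
  exact: norm_continuous.
have lo : l1norm (p + 0 *: u) <= M%:R.
  rewrite scale0r addr0 -(ler_pXn2r (ltn0Sn 1)) ?nnegrE ?sumr_ge0 //.
  apply: le_trans (sqr_sum_norm_le p) _.
  apply: le_trans (ler_wpM2l (ler0n _ _) (S_bounded Sp)) _.
  rewrite -!natrX -natrM ler_nat; apply: leq_trans M_large.
  by rewrite mulnC -mulnA leq_pmull.
have hi : M%:R <= l1norm (p + s1 *: u).
  rewrite /l1norm (bigD1 i) //=; apply: ler_wpDr; first exact: sumr_ge0.
  rewrite !mxE; have := lerB_normD (s1 * u 0 i) (p 0 i).
  rewrite normrM (ger0_norm s10) /s1 divfK ?gt_eqF // addrK => hh.
  by rewrite addrC.
have [|s /itvP sI <-] := IVT s10 (continuous_subspaceT cont) (v := M%:R).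
  have := le_trans lo hi => lohi.
  by rewrite (min_idPl lohi) (max_idPr lohi) lo hi.
by exists s => //; rewrite sI.
Qed.

(* Dudley's approximation: one supporting half-space per cell of a sphere
   enclosing [S].  The error is quadratic in the diameter of a cell because
   the nearest-point map is firmly nonexpansive. *)
Lemma dudley :
  exists (a : 'I_(2 ^ k.+1 * 'C(k + M, k)) -> 'rV[R]_k.+1) (b : _ -> R),
  [/\ forall i, 0 < b i,
      forall x i, S x -> frob (a i) x <= b i &
      forall x, (forall i, frob (a i) x <= b i) ->
        exists2 p, S p & frob (x - p) (x - p) <= (2 * k.+1%:R / n%:R) ^+ 2].
Proof.
rewrite -card_cells.
pose P (i : 'I_#|cells k M|) w p :=
  [/\ l1norm w = M%:R, cell M w = enum_val i & normal_at w p].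
(* A cell containing a suitable [w] contributes its supporting half-space; any other cell gets the
   trivial inequality 0 <= 1. *)
have /choice[ab abP] : forall i, exists ab : 'rV[R]_k.+1 * R,
    [/\ 0 < ab.2, forall x, S x -> frob ab.1 x <= ab.2 &
      forall w p, P i w p -> exists w' p',
        P i w' p' /\ ab = (w' - p', frob (w' - p') p')].
  move=> i; have [[w [p Pwp]]|noP] := pselect (exists w p, P i w p).
    exists (w - p, frob (w - p) p); have [wM _ np] := Pwp; split=> /=.
    - exact: normal_level_gt0.
    - by move=> x Sx; rewrite -subr_le0 -frobNr -frobDr; apply np.2.
    - by exists w, p.
  exists (0, 1); split=> //= [x _|w p Pwp].
    by rewrite frobC raddf0 ler01.
  by exfalso; apply: noP; exists w, p.
exists (fun i => (ab i).1), (fun i => (ab i).2); split.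
- by move=> i; have [] := abP i.
- by move=> x i; have [_ + _] := abP i; apply.
move=> x xK; have S0 : S 0 by apply: S_ball; rewrite raddf0 ler01.
have [p Sp pn] : exists2 p, S p & forall q, S q -> frob (x - p) (q - p) <= 0.
  by apply: (exists_nearest (r := n%:R)) => //; exists 0.
exists p => //; have [->|xp0] := eqVneq (x - p) 0.
  by rewrite raddf0 sqr_ge0.
(* Pushing [x] out to the sphere along the normal keeps [p] as nearest point, so the cell of [w] has
   a chosen representative [w']. *)
have [s s0 wM] := extend_to_sphere Sp xp0.
set w := p + s *: (x - p) in wM.
have wp : w - p = s *: (x - p) by rewrite /w addrC addKr.
have nw : normal_at w p.
  by split=> // q Sq; rewrite wp frobZl mulr_ge0_le0 // pn.
have wn := normal_far wM nw.
have sp : 0 < s.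
  rewrite lt_def s0 andbT; apply: contraTneq wn => s00.
  by rewrite wp s00 scale0r raddf0 -ltNge exprn_gt0.
pose i := enum_rank_in (cell_mem wM) (cell M w).
have [w' [p' [[w'M cw' [Sp' np']] abE]]] : exists w' p',
    P i w' p' /\ ab i = (w' - p', frob (w' - p') p').
  have [_ _] := abP i; apply; split; [exact: wM| |exact: nw].
  by rewrite enum_rankK_in // cell_mem.
have xE : x = p + s^-1 *: (w - p) by rewrite wp scalerA mulVf ?gt_eqF // scale1r addrC subrK.
have -> : x - p = s^-1 *: (w - p) by rewrite wp scalerA mulVf ?gt_eqF // scale1r.
apply: (@dudley_estimate _ p p' (w - p) (w' - p')) => //.
- by rewrite invr_ge0.
- by rewrite -natrX -natrM ler_nat.
- by apply: normal_far w'M _.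
- exact: nw.2.
- exact: np'.
- rewrite !subrK; apply: (@cell_dist _ _ M) => //.
  by rewrite cw' enum_rankK_in // cell_mem.
- have := xK i; rewrite abE /= -subr_le0 -frobNr -frobDr.
  by rewrite {1}xE.
Qed.

End Dudley.

(** * The number of cells *)

Section Counting.
Variable R : realType.

Lemma expR_ge_pow_fact (x : R) k : 0 <= x -> x ^+ k <= expR x * k`!%:R.
Proof.
move=> x0; rewrite -ler_pdivrMr ?ltr0n ?fact_gt0 //.
case: k => [|k].
  by rewrite expr0 fact0 divr1; apply: le_trans (expR_ge1Dx x); rewrite lerDl.
by apply: le_trans (expR_ge1Dxn k x0); rewrite lerDr.
Qed.

(** An integer substitute for the square root of [d], up to a factor 2. *)
Lemma exists_sqr_between d : exists s, (d <= s ^ 2 <= 4 * d)%N.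
Proof.
case: d => [|d]; first by exists 0%N.
elim: d => [|d [s /andP[ls us]]]; first by exists 1%N.
have [ds|ds] := ltnP d.+1 (s ^ 2)%N.
  by exists s; rewrite ds /= (leq_trans us) // leq_mul2l leqnSn orbT.
exists s.+1; move: ls us ds; rewrite !expnS !expn0; nia.
Qed.

Lemma ffact_le_exp n k : (n ^_ k <= n ^ k)%N.
Proof.
elim: k n => [|k IH] n //; case: n => [|n]; first by rewrite ffact_small.
rewrite ffactnS expnS leq_mul2l /=; apply: leq_trans (IH n) _.
by case: k {IH} => // k; rewrite leq_exp2r.
Qed.

(** Squaring avoids square roots. The binomial is at most [(k + M) ^ k / k!]; in the square, one
    factorial absorbs [k.+1 ^ k] and the other absorbs the remaining exponential [(136 * e) ^ k]. *)
Lemma cell_count : exists2 C : R, 0 < C & forall k n, (k.+1 <= n)%N ->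
  exists2 M, (4 * n ^ 2 * k.+1 <= M ^ 2)%N &
    (2 ^ k.+1 * 'C(k + M, k))%:R <= C * n%:R ^+ k.
Proof.
pose e := expR 1 : R.
have e0 : 0 < e := expR_gt0 1.
pose C0 := 4 * e * expR (136 * e).
have C00 : 0 < C0 by rewrite !mulr_gt0 ?expR_gt0.
exists (1 + C0) => [|k n kn]; first by rewrite addr_gt0.
have [s /andP[ls us]] := exists_sqr_between k.+1.
exists (2 * n * s)%N.
  by rewrite !expnMn leq_mul2l ls orbT.
set M := (2 * n * s)%N.
(* 34 is 2 * (16 + 1), from (k + M)^2 <= 2 (k^2 + M^2); the later 136 is 4 * 34, the 4 coming from
   the square of the power of 2. *)
have Mk : ((k + M) ^ 2 <= 34 * n ^ 2 * k.+1)%N.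
  have M2 : (M ^ 2 <= 16 * n ^ 2 * k.+1)%N.
    rewrite /M !expnMn (_ : 16 * n ^ 2 * k.+1 = (2 ^ 2 * n ^ 2) * (4 * k.+1))%N; last by ring.
    by rewrite leq_mul2l us orbT.
  have k2 : (k ^ 2 <= n ^ 2 * k.+1)%N.
    by apply: (@leq_trans (n ^ 2)); rewrite ?leq_pmulr // leq_exp2r // ltnW.
  have := (nat_Cauchy k M).1; rewrite sqrnD; lia.
set B := 'C(k + M, k).
have BF : (B ^ 2 * k`! ^ 2 <= 34 ^ k * (n ^ k) ^ 2 * k.+1 ^ k)%N.
  rewrite -expnMn /B bin_ffact; apply: (@leq_trans (((k + M) ^ k) ^ 2)).
    by rewrite leq_exp2r // ffact_le_exp.
  rewrite -!expnM (mulnC k) !expnM -!expnMn; move: Mk.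
  by case: (k) (_ + _)%N => // k' l; rewrite leq_exp2r.
have kF : k.+1%:R ^+ k <= e ^+ k.+1 * k`!%:R.
  by rewrite -expRM_natl mulr1; apply: expR_ge_pow_fact.
have eF : (136 * e) ^+ k <= expR (136 * e) * k`!%:R.
  by apply: expR_ge_pow_fact; rewrite mulr_ge0 // ltW.
have F0 : 0 < k`!%:R :> R by rewrite ltr0n fact_gt0.
have N0 : 0 <= n%:R ^+ k :> R by rewrite exprn_ge0.
rewrite -(ler_pXn2r (ltn0Sn 1)) ?nnegrE ?mulr_ge0 ?addr_ge0 ?(ltW C00) //.
apply: (@le_trans _ _ (C0 * (n%:R ^+ k) ^+ 2)); last first.
  by rewrite exprMn; apply: ler_wpM2r; [exact: exprn_ge0|have := ltW C00; nra].
have F2 : 0 < k`!%:R ^+ 2 :> R by rewrite exprn_gt0.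
rewrite -(ler_pM2r F2).
have BF' : B%:R ^+ 2 * k`!%:R ^+ 2 <= 34 ^+ k * (n%:R ^+ k) ^+ 2 * k.+1%:R ^+ k :> R.
  by move: BF; rewrite -(ler_nat R) !natrM !natrX.
rewrite natrM natrX exprMn -mulrA.
apply: le_trans (ler_wpM2l _ BF') _; first by rewrite exprn_ge0 // exprn_ge0.
have -> : (2 ^+ k.+1) ^+ 2 = 4 * 4 ^+ k :> R.
  by rewrite -exprM mulnC exprM exprS; congr (_ * _ ^+ _); ring.
have NN0 : 0 <= (n%:R ^+ k) ^+ 2 :> R by rewrite exprn_ge0.
move: NN0; move: ((n%:R ^+ k) ^+ 2) => NN NN0.
have h : 136 ^+ k * k.+1%:R ^+ k <= e * expR (136 * e) * k`!%:R ^+ 2.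
  apply: le_trans (ler_wpM2l (exprn_ge0 k (ler0n _ 136)) kF) _.
  rewrite exprS !mulrA (mulrAC _ e) -exprMn.
  have := ler_wpM2l (mulr_ge0 (ltW e0) (ltW F0)) eF.
  move: ((136 * e) ^+ k) (expR _) => x y; lra.
have -> : 4 * 4 ^+ k * (34 ^+ k * NN * k.+1%:R ^+ k) = 4 * NN * (136 ^+ k * k.+1%:R ^+ k) :> R.
  have -> : 136 = 4 * 34 :> R by ring.
  by rewrite exprMn; ring.
apply: le_trans (ler_wpM2l _ h) _; first by rewrite mulr_ge0.
by rewrite le_eqVlt /C0; apply/orP; left; apply/eqP; ring.
Qed.

End Counting.

(** * Linear subspaces of matrices *)

Section Orthonormal.
Variables (R : realType) (p q : nat).
Implicit Types W : {vspace 'M[R]_(p, q)}.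

Lemma dim_cap_scalar_ker (V : vectType R) (W : {vspace V}) (f : {scalar V}) v :
  v \in W -> f v != 0 ->
  \dim W = (\dim (W :&: lker (linfun (f : {linear V -> R^o}))))%VS.+1.
Proof.
move=> vW fv; rewrite -(limg_ker_dim (linfun (f : {linear V -> R^o})) W).
set D := (_ @: _)%VS; suff -> : \dim D = 1%N by rewrite addn1.
apply/eqP; rewrite eqn_leq; apply/andP; split.
  by apply: leq_trans (dimvS (subvf D)) _; rewrite dimvf.
rewrite lt0n dimv_eq0; apply/eqP => D0.
have : linfun (f : {linear V -> R^o}) v \in D by apply: memv_img.
by rewrite D0 memv0 lfunE (negbTE fv).
Qed.

(** Gram-Schmidt: normalise one vector of [W] and recurse on its orthogonal complement in [W]. *)
Lemma orthonormal_basis d W : \dim W = d ->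
  exists e : 'I_d -> 'M[R]_(p, q),
  [/\ forall i, e i \in W, forall i j, frob (e i) (e j) = (i == j)%:R &
      forall X, X \in W -> X = \sum_i frob (e i) X *: e i].
Proof.
elim: d W => [|d IH] W dW.
  exists (fun=> 0); split=> [i|[]//|X]; first exact: rpred0.
  by move/eqP: dW; rewrite dimv_eq0 => /eqP->; rewrite memv0 big_ord0 => /eqP.
pose v := vpick W.
have v0 : v != 0 by rewrite vpick0 -dimv_eq0 dW.
have vv := frob_gt0 v0.
pose u := (Num.sqrt (frob v v))^-1 *: v.
have uW : u \in W by rewrite rpredZ // memv_pick.
have uu : frob u u = 1.
  rewrite /u frobZl frobZr mulrA -invfM -expr2 sqr_sqrtr ?ltW //.
  by rewrite mulVf // gt_eqF.
have [|e [eW eo eX]] := IH (W :&: lker (linfun (frob u : {linear _ -> R^o})))%VS.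
  have := dim_cap_scalar_ker uW (f := frob u); rewrite /= uu oner_neq0 dW.
  by move=> /(_ isT) [].
have eu i : frob u (e i) = 0.
  by have := eW i; rewrite memv_cap mem_ker_scalar => /andP[_ /eqP].
pose e' i := if unlift ord0 i is Some j then e j else u.
have e'0 : e' ord0 = u by rewrite /e' unlift_none.
have e'S j : e' (lift ord0 j) = e j by rewrite /e' liftK.
exists e'; split=> [i|i j|X XW].
- by case: (unliftP ord0 i) => [j|] ->; rewrite ?e'0 // e'S;
    have := eW j; rewrite memv_cap => /andP[].
- case: (unliftP ord0 i) => [i'|] ->; case: (unliftP ord0 j) => [j'|] ->;
    rewrite !(e'0, e'S) ?uu ?eqxx ?eu //.
  by rewrite frobC eu.
rewrite big_ord_recl e'0.
have YW : X - frob u X *: u \in (W :&: lker (linfun (frob u : {linear _ -> R^o})))%VS.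
  by rewrite memv_cap mem_ker_scalar rpredB ?rpredZ ?memv_pick //= frobDr frobNr frobZr uu mulr1 subrr.
rewrite -[LHS](subrK (frob u X *: u)) addrC {1}(eX _ YW); congr (_ + _).
apply: eq_bigr => i _; rewrite e'S frobDr frobNr frobZr (frobC _ u) eu mulr0.
by rewrite oppr0 addr0.
Qed.

Lemma subspace_equations W : exists Y : 'I_p * 'I_q -> 'M[R]_(p, q),
  forall X, X \in W <-> forall x, frob (Y x) X = 0.
Proof.
have [e [eW _ eX]] := orthonormal_basis (erefl (\dim W)).
(* Pairing with [Y x] reads the entry [x] of [X] minus its orthogonal projection on [W]. *)
pose Y x := delta_mx x.1 x.2 - \sum_i e i x.1 x.2 *: e i.
have frobY x X : frob (Y x) X = (X - \sum_i frob (e i) X *: e i) x.1 x.2.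
  rewrite frobDl frobNl !mxE; congr (_ - _).
    rewrite /frob (bigD1 x) //= mxE !eqxx mul1r big1 ?addr0 // => -[i j] ne.
    rewrite mxE; case: eqP => [E1|_]; last by rewrite mul0r.
    case: eqP => [E2|_]; last by rewrite andbF mul0r.
    by move: ne; rewrite /= in E1 E2 *; rewrite E1 E2 -surjective_pairing eqxx.
  rewrite frobC raddf_sum summxE; apply: eq_bigr => i _.
  by rewrite /= frobZr mxE mulrC frobC.
exists Y => X; split=> [XW x|XY].
  by rewrite frobY -eX // subrr mxE.
have -> : X = \sum_i frob (e i) X *: e i.
  apply/eqP; rewrite -subr_eq0; apply/eqP/matrixP => i j.
  by have := XY (i, j); rewrite frobY => ->; rewrite mxE.
by apply: rpred_sum => i _; rewrite rpredZ ?eW.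
Qed.

(** Orthonormal coordinates identify [W] isometrically with row vectors, where [dudley] applies. *)
Lemma dudley_subspace W k M n (J : Type) (G : J -> 'M[R]_(p, q)) (h : J -> R)
    (S := [set X | X \in W /\ forall j, frob (G j) X <= h j]) :
  \dim W = k.+1 -> (0 < n)%N ->
  (forall X, X \in W -> frob X X <= 1 -> S X) ->
  (forall X, S X -> frob X X <= n%:R ^+ 2) ->
  (4 * k.+1 <= n ^ 2)%N -> (4 * n ^ 2 * k.+1 <= M ^ 2)%N ->
  exists (A : 'I_(2 ^ k.+1 * 'C(k + M, k)) -> 'M[R]_(p, q)) (b : _ -> R),
  [/\ forall i, 0 < b i,
      forall X i, S X -> frob (A i) X <= b i &
      forall X, X \in W -> (forall i, frob (A i) X <= b i) ->
        exists2 P, S P & frob (X - P) (X - P) <= (2 * k.+1%:R / n%:R) ^+ 2].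
Proof.
move=> dW n0 Sball Sbound kn Mn.
have [e [eW eo eX]] := orthonormal_basis dW.
pose emb (c : 'rV[R]_k.+1) := \sum_i c 0 i *: e i.
pose crd X := \row_i frob (e i) X.
have embW c : emb c \in W by apply: rpred_sum => i _; rewrite rpredZ ?eW.
have crdK X : X \in W -> emb (crd X) = X.
  by move=> XW; rewrite [RHS]eX //; apply: eq_bigr => i _; rewrite mxE.
have frob_emb X c : frob X (emb c) = frob (crd X) c.
  rewrite frob_rV /emb raddf_sum; apply: eq_bigr => i _.
  by rewrite /= frobZr mxE mulrC frobC.
have embK c : crd (emb c) = c.
  apply/rowP => i; rewrite mxE /emb raddf_sum (bigD1 i) //= frobZr eo eqxx mulr1.
  by rewrite big1 ?addr0 // => j ji; rewrite frobZr eo eq_sym (negbTE ji) mulr0.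
have iso c : frob (emb c) (emb c) = frob c c by rewrite frob_emb embK.
have SE c : [set c | forall j, frob (crd (G j)) c <= h j] c <-> S (emb c).
  split=> [Sc|[_ Sc] j]; last by rewrite -frob_emb.
  by split=> // j; rewrite frob_emb.
have [||a [b [b0 aS aK]]] := @dudley R k M n J (crd \o G) h n0 _ _ kn Mn.
- by move=> c c1; apply/SE/Sball; rewrite ?iso.
- by move=> c /SE/Sbound; rewrite iso.
exists (emb \o a), b; split=> // [X i SX|X XW XA] /=.
  have [XW _] := SX; rewrite frobC frob_emb frobC; apply: aS; apply/SE.
  by rewrite crdK.
have [|c Sc hc] := aK (crd X).
  by move=> i; have := XA i; rewrite /= frobC frob_emb frobC.
exists (emb c); first exact/SE.
apply: le_trans hc; rewrite -iso le_eqVlt; apply/orP; left; apply/eqP.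
have -> : emb (crd X - c) = X - emb c => //.
rewrite -{2}(crdK X XW) /emb -sumrB; apply: eq_bigr => i _.
by rewrite !mxE scalerBl.
Qed.

End Orthonormal.

(** * The base of a spectrahedron *)

Section Spectrahedron.
Variables (R : realType) (n : nat).
Implicit Types (E : set 'M[R]_n) (U : {vspace 'M[R]_n}) (Q X : 'M[R]_n).

Lemma quad_frob (x : 'cV[R]_n) Q : (x^T *m Q *m x) 0 0 = frob (x *m x^T) Q.
Proof.
rewrite frobMx -mulmxA mxE; apply: eq_bigr => i _; rewrite !mxE mulr_sumr.
by apply: eq_bigr => j _; rewrite !mxE big_ord1 !mxE; ring.
Qed.

Lemma frob1 Q : frob 1%:M Q = \tr Q.
Proof.
rewrite frobMx; apply: eq_bigr => i _; rewrite (bigD1 i) //= big1 => [|j ji].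
  by rewrite mxE eqxx mul1r addr0.
by rewrite mxE eq_sym (negbTE ji) mul0r.
Qed.

Lemma frob_rank1 (x : 'cV[R]_n) :
  frob (x *m x^T) (x *m x^T) = frob (x *m x^T) 1%:M ^+ 2.
Proof.
rewrite [frob _ 1%:M]frobC frob1 frobMx expr2 mulr_suml; apply: eq_bigr => i _.
by rewrite mulr_sumr; apply: eq_bigr => j _; rewrite !mxE !big_ord1 !mxE; ring.
Qed.

Lemma frob_rank1_ge0 (x : 'cV[R]_n) : 0 <= frob (x *m x^T) 1%:M.
Proof.
rewrite -quad_frob mulmx1 mxE; apply: sumr_ge0 => i _.
by rewrite mxE -expr2 sqr_ge0.
Qed.

Lemma quad_delta2 Q i j (s t : R) : Q^T = Q ->
  (let x : 'cV_n := s *: delta_mx i 0 + t *: delta_mx j 0 in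
   (x^T *m Q *m x) 0 0) = s ^+ 2 * Q i i + 2 * s * t * Q i j + t ^+ 2 * Q j j.
Proof.
move=> Qs /=.
have D a b : (delta_mx a 0 : 'cV[R]_n)^T *m Q *m (delta_mx b 0 : 'cV[R]_n) = (Q a b)%:M.
  by rewrite trmx_delta -rowE -colE; apply/matrixP => k l; rewrite !ord1 !mxE mulr1n.
have Qji : Q j i = Q i j by rewrite -{1}Qs mxE.
have -> : (s *: delta_mx i 0 + t *: delta_mx j 0 : 'cV[R]_n)^T =
    s *: (delta_mx i 0)^T + t *: (delta_mx j 0)^T by rewrite linearD !linearZ.
rewrite !(mulmxDl, mulmxDr) -!scalemxAl -!scalemxAr.
by rewrite !D Qji !mxE !mulr1n; ring.
Qed.

(** Nonnegativity of a 2 x 2 principal minor, tested on combinations of two basis vectors. *)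
Lemma psd_entry_le Q i j : psd Q -> Q i j ^+ 2 <= Q i i * Q j j.
Proof.
move=> [Qs Qp].
have quad s t : 0 <= s ^+ 2 * Q i i + 2 * s * t * Q i j + t ^+ 2 * Q j j.
  by rewrite -(quad_delta2 _ _ _ _ Qs); exact: Qp.
have := quad 0 1; have := quad 1 0; move: quad.
move: (Q i i) (Q j j) (Q i j) => a b c quad.
rewrite !(expr0n, expr1n, mulr0, mul0r, mul1r, addr0, add0r) => a0 b0.
have [bz|bn] := eqVneq b 0; last first.
  have bp : 0 < b by rewrite lt_def bn.
  (* At [(b, - c)] the form equals [b * (a * b - c ^+ 2)]. *)
  by rewrite -subr_ge0 -(pmulr_rge0 _ bp); apply: le_trans (quad b (- c)) _; nra.
rewrite bz mulr0; have [->|cn] := eqVneq c 0; first by rewrite expr0n.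
(* With [b = 0] and [s = 1] the form is affine in [t]; this [t] gives it the value -1. *)
have := quad 1 (- (a + 1) / (2 * c)).
have -> : 1 ^+ 2 * a + 2 * 1 * (- (a + 1) / (2 * c)) * c +
    (- (a + 1) / (2 * c)) ^+ 2 * b = - 1 by rewrite bz; field.
by rewrite lerNr oppr0 ler10.
Qed.

Lemma psd_frob_le Q : psd Q -> frob Q Q <= \tr Q ^+ 2.
Proof.
move=> Qp; rewrite frobMx expr2 mulr_suml; apply: ler_sum => i _.
rewrite mulr_sumr; apply: ler_sum => j _.
by rewrite -expr2 psd_entry_le.
Qed.

Definition traceless (U : {vspace 'M[R]_n}) : {vspace 'M[R]_n} :=
  (U :&: lker (linfun (@trmx R n n) - \1)%VF
     :&: lker (linfun (@mxtrace R n : {linear 'M[R]_n -> R^o})))%VS.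

Lemma mem_traceless U X : X \in traceless U <-> [/\ X \in U, X^T = X & \tr X = 0].
Proof.
rewrite !memv_cap memv_ker add_lfunE opp_lfunE id_lfunE lfunE /= subr_eq0 mem_ker_scalar.
split=> [/andP[/andP[XU /eqP Xs] /eqP trX] //|[XU Xs trX]].
by rewrite XU Xs eqxx; apply/eqP.
Qed.

(** Presents the body as a section by half-spaces with normals [- (x *m x^T)], the form that
    [dudley_subspace] takes. *)
Lemma Pos_base_shiftedE E U X : E = [set Q | Q - 1%:M \in U] ->
  Pos_base_shifted E X <->
  X \in traceless U /\ forall x : 'cV_n, frob (- (x *m x^T)) X <= frob (x *m x^T) 1%:M.
Proof.
move=> EU; split=> [[Q [[[Qs Qp] EQ] trQ] <-]|[/mem_traceless[XU Xs trX] Xp]].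
  split=> [|x].
    apply/mem_traceless; split; first by move: EQ; rewrite EU.
      by rewrite linearB /= Qs trmx1.
    by rewrite linearB /= trQ mxtrace1 subrr.
  by have := Qp x; rewrite quad_frob frobNl frobDr frobNr; lra.
exists (X + 1%:M); last by rewrite addrK.
split; last by rewrite mxtraceD trX mxtrace1 add0r.
split; last by rewrite EU /= addrK.
split=> [|x]; first by rewrite linearD /= Xs trmx1.
by have := Xp x; rewrite quad_frob frobNl frobDr; lra.
Qed.

Lemma Pos_base_shifted_ball E U X : E = [set Q | Q - 1%:M \in U] ->
  X \in traceless U -> frob X X <= 1 -> Pos_base_shifted E X.
Proof.
move=> EU XU X1; apply/(Pos_base_shiftedE _ EU); split=> // x.
have := frob_CS (- (x *m x^T)) X; rewrite frobNN frob_rank1 => CS.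
have q0 := frob_rank1_ge0 x.
apply: le_trans (ler_norm _) _.
rewrite -(ler_pXn2r (ltn0Sn 1)) ?nnegrE // real_normK ?num_real //.
by apply: le_trans CS _; rewrite ler_piMr // sqr_ge0.
Qed.

Lemma Pos_base_shifted_bounded E X : Pos_base_shifted E X -> frob X X <= n%:R ^+ 2.
Proof.
move=> [Q [[Qp _] trQ] <-].
(* The squared norm of [Q - 1] is that of [Q] minus [n]. *)
have := psd_frob_le Qp; rewrite trQ !frobE (frobC Q) !frob1 trQ mxtrace1.
have := ler0n R n; lra.
Qed.

End Spectrahedron.

(** * Scaling factor and construction of the polytope *)

Lemma scaling_factor_ge (R : realType) (n m : nat) : (0 < m)%N ->
  m%:R <= n%:R / expR 1 :> R ->
  1 + 2 * m%:R / n%:R <= (1 + n%:R / m%:R) `^ (3 * m%:R / n%:R) :> R.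
Proof.
move=> m0 mn.
have m0R : 0 < m%:R :> R by rewrite ltr0n.
have enm : expR 1 <= n%:R / m%:R :> R.
  by rewrite ler_pdivlMr // mulrC -ler_pdivlMr ?expR_gt0.
have nm0 : 0 < n%:R / m%:R :> R := lt_le_trans (expR_gt0 1) enm.
rewrite /powR gt_eqF ?addr_gt0 //.
apply: le_trans (expR_ge1Dx _); rewrite lerD2l.
(* The hypothesis [m <= n / e] enters here: the base of the power exceeds [e]. *)
have l1 : 1 <= ln (1 + n%:R / m%:R) :> R.
  rewrite -[leLHS](expRK 1) ler_ln ?posrE ?expR_gt0 ?addr_gt0 //.
  by apply: le_trans enm _; rewrite lerDr.
have mn0 : 0 <= m%:R / n%:R :> R by rewrite divr_ge0.
have := ler_wpM2l mn0 l1; rewrite -!mulrA; lra.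
Qed.

Lemma polytope_frob (R : realType) n (W : {vspace 'M[R]_n}) N
    (A : 'I_N -> 'M[R]_n) (b : 'I_N -> R) r :
  (forall X, X \in W -> (forall i, frob (A i) X <= b i) -> frob X X <= r ^+ 2) ->
  polytope [set X | X \in W /\ forall i, frob (A i) X <= b i].
Proof.
move=> bound; have [Y YW] := subspace_equations W.
split; last first.
  exists `|r| => X [XW XA] i j.
  rewrite -(ler_pXn2r (ltn0Sn 1)) ?nnegrE // !real_normK ?num_real //.
  apply: le_trans (bound X XW XA).
  rewrite /frob (bigD1 (i, j)) //= -expr2 lerDl.
  by apply: sumr_ge0 => x _; rewrite -expr2 sqr_ge0.
pose T := ('I_N + ('I_n * 'I_n) * bool)%type.
(* Each linear equation of [W] is split into two opposite inequalities, indexed by a boolean. *)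
pose B (t : T) := match t with
  | inl i => A i | inr (x, s) => (-1) ^+ s *: Y x end.
pose c (t : T) := if t is inl i then b i else 0.
exists #|{: T}|, (fun i => frob (B (enum_val i))), (fun i => c (enum_val i)).
apply/seteqP; split=> X /=.
  move=> [/YW XY XA] i; case: (enum_val i) => [j|[x s]] /=; first exact: XA.
  by rewrite frobZl XY mulr0.
move=> XB; have {}XB t : frob (B t) X <= c t.
  by have := XB (enum_rank t); rewrite enum_rankK.
split=> [|i]; last exact: (XB (inl i)).
apply/YW => x; apply/eqP; rewrite eq_le.
have := XB (inr (x, false)); have := XB (inr (x, true)).
by rewrite /= expr1 expr0 !frobZl mulN1r mul1r oppr_le0 => -> ->.
Qed.

(** By Cauchy-Schwarz, passing from [P] to [X] costs at most [eps * q] in the inequality of level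
    [q], so [X] satisfies it at level [alpha * q]. *)
Lemma enlarged_in_scaled (R : realType) n (E : set 'M[R]_n) (U : {vspace 'M[R]_n}) X P (eps alpha : R) :
  E = [set Q | Q - 1%:M \in U] -> X \in traceless U ->
  Pos_base_shifted E P -> frob (X - P) (X - P) <= eps ^+ 2 -> 0 <= eps ->
  1 + eps <= alpha -> [set alpha *: Y | Y in Pos_base_shifted E] X.
Proof.
move=> EU XW SP XP e0 ea; have a0 : 0 < alpha by apply: lt_le_trans ea; rewrite ltr_pwDl.
exists (alpha^-1 *: X); last by rewrite scalerA divff ?gt_eqF // scale1r.
apply/(Pos_base_shiftedE _ EU); split; first by rewrite rpredZ.
move=> x; have /(Pos_base_shiftedE _ EU) [PW /(_ x) Px] := SP.
have q0 := frob_rank1_ge0 x.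
set q := frob (x *m x^T) 1%:M in Px q0 *.
have hXP : frob (- (x *m x^T)) (X - P) <= eps * q.
  have := frob_CS (- (x *m x^T)) (X - P); rewrite frobNN frob_rank1 -/q => CS.
  apply: le_trans (ler_norm _) _.
  rewrite -(ler_pXn2r (ltn0Sn 1)) ?nnegrE ?mulr_ge0 // real_normK ?num_real //.
  apply: le_trans CS _; rewrite exprMn mulrC; apply: ler_wpM2r => //.
  exact: sqr_ge0.
rewrite frobZr ler_pdivrMl // -[X](subrK P) frobDr.
have := ler_wpM2r q0 ea; lra.
Qed.

Theorem corollary1p5 (R : realType) :
  exists C : R, 0 < C /\
  forall (n m : nat) (E : set 'M[R]_n),
    affine_space m E ->
    m%:R <= n%:R / expR 1 :> R ->
    E 1%:M ->
    (* the hyperplane Tr = n does not contain E *)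
    (exists Q, E Q /\ \tr Q <> n%:R) ->
    exists (K : set 'M[R]_n) (N : nat),
      [/\ polytope K,
          (facets K #= `I_N)%card,
          N%:R <= C * n%:R ^ (m%:Z - 2),
          Pos_base_shifted E `<=` K &
          K `<=` [set (1 + n%:R / m%:R) `^ (3 * m%:R / n%:R) *: X
                  | X in Pos_base_shifted E]].
Proof.
have [C C0 HC] := cell_count R; exists C; split=> // n m E aE mn E1 [Q0 [EQ0 trQ0]].
have [U dU EU] := affine_translate aE E1.
set W := traceless U.
(* If [W] were all of [U], every matrix of [E] would have trace [n], unlike [Q0]. *)
have W_lt : (\dim W < m)%N.
  have Q0U : Q0 - 1%:M \in U by move: EQ0; rewrite EU.
  rewrite -dU ltn_neqAle dimvS ?andbT; last by apply/subvP => X /mem_traceless[].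
  apply/negP => eqd; have /eqP WU : W == U.
    by rewrite eqEdim (eqP eqd) leqnn andbT; apply/subvP => X /mem_traceless[].
  move: Q0U; rewrite -WU => /mem_traceless[_ _].
  by rewrite linearB /= mxtrace1 => /eqP; rewrite subr_eq0 => /eqP.
have m0 : (0 < m)%N by apply: leq_ltn_trans W_lt.
have alpha_ge := scaling_factor_ge m0 mn.
set alpha := _ `^ _ in alpha_ge *.
have mn2 : (2 * m <= n)%N.
  have e2 : 2 <= expR 1 :> R by apply: le_trans (expR_ge1Dx 1); lra.
  rewrite -(ler_nat R) natrM; move: mn; rewrite ler_pdivlMr ?expR_gt0 //.
  by apply: le_trans; rewrite mulrC ler_wpM2l.
have n0 : (0 < n)%N by apply: leq_trans mn2; rewrite muln_gt0.
have [N [A [b [b0 AS AK NC]]]] : exists N (A : 'I_N -> 'M[R]_n) (b : 'I_N -> R),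
    [/\ forall i, 0 < b i,
      forall X i, Pos_base_shifted E X -> frob (A i) X <= b i,
      forall X, X \in W -> (forall i, frob (A i) X <= b i) ->
        exists2 P, Pos_base_shifted E P &
          frob (X - P) (X - P) <= (2 * m%:R / n%:R) ^+ 2 &
      N%:R <= C * n%:R ^ (m%:Z - 2)].
  (* In dimension 0 the body is a point and no half-space is used. This covers [m = 1], where the
     exponent [m - 2] is negative. *)
  case dW : (\dim W) => [|k].
    exists 0%N, (fun=> 0), (fun=> 1); split=> [[]//|X []//|X XW _|].
      exists X; last by rewrite subrr raddf0 sqr_ge0.
      apply: (Pos_base_shifted_ball EU) => //; move/eqP: dW XW.
      by rewrite dimv_eq0 => /eqP->; rewrite memv0 => /eqP->; rewrite raddf0.
    by rewrite mulr_ge0 ?exprz_ge0 // ltW.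
  have km : (k.+2 <= m)%N by rewrite -dW.
  have kn : (k.+1 <= n)%N by apply: leq_trans mn2; lia.
  have [M Mlarge NC] := HC k n kn.
  have SE : Pos_base_shifted E = [set X | X \in W /\
      forall x : 'cV_n, frob (- (x *m x^T)) X <= frob (x *m x^T) 1%:M].
    by apply/seteqP; split=> X /(Pos_base_shiftedE _ EU).
  have [|||A [b [b0 AS AK]]] := @dudley_subspace R n n W k M n _
    (fun x : 'cV[R]_n => - (x *m x^T)) (fun x => frob (x *m x^T) 1%:M) dW n0 _ _ _ Mlarge.
  - by move=> X XW X1; have := Pos_base_shifted_ball EU XW X1; rewrite SE.
  - by rewrite -SE => X; exact: Pos_base_shifted_bounded.
  - by rewrite expnS expn1; nia.
  exists (2 ^ k.+1 * 'C(k + M, k))%N, A, b; split=> //.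
  - by move=> X i; rewrite SE; exact: AS.
  - move=> X XW XA; have [P SP XP] := AK X XW XA; exists P; first by rewrite SE.
    apply: le_trans XP _; rewrite ler_pXn2r ?nnegrE ?divr_ge0 ?mulr_ge0 //.
    rewrite ler_wpM2r ?invr_ge0 // ler_wpM2l // ler_nat; exact: ltnW.
  apply: le_trans NC _; rewrite ler_wpM2l ?(ltW C0) //.
  have m2 : (2 <= m)%N by apply: leq_trans km.
  have -> : m%:Z - 2 = (m - 2)%N by rewrite -subzn.
  rewrite -exprnP; apply: ler_weXn2l; first by rewrite ler1n.
  by rewrite leq_subRL ?(leq_trans _ km) // add2n.
pose K := [set X | X \in W /\ forall i, frob (A i) X <= b i].
have eps0 : 0 <= 2 * m%:R / n%:R :> R by rewrite divr_ge0 ?mulr_ge0.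
have Kalpha : K `<=` [set alpha *: X | X in Pos_base_shifted E].
  move=> X [XW XA]; have [P SP XP] := AK X XW XA.
  exact: (enlarged_in_scaled EU XW SP XP).
have [N' N'N facN'] := card_facets_le W (fun i => frob (A i)) b0.
exists K, N'; split=> //.
(* [K] is bounded, being inside the dilated base, of radius at most [alpha * n]. *)
- apply: (@polytope_frob _ _ _ _ _ _ (alpha * n%:R)) => X XW XA.
  have [Y SY <-] := Kalpha X (conj XW XA).
  rewrite frobZl frobZr mulrA -expr2 exprMn ler_wpM2l ?sqr_ge0 //.
  exact: Pos_base_shifted_bounded SY.
- by apply: le_trans NC; rewrite ler_nat.
move=> X SX; split; last by move=> i; exact: AS.
by have /(Pos_base_shiftedE _ EU)[] := SX.
Qed.
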